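(* For any Rademacher sum $X=\sum_{i=1}^na_i\varepsilon_i\in\mathcal{X}$, we have $\mathbb{P}(|X|\geq 1/\sqrt{7})\geq 1/2$.
   Context: $\mathcal{X}$ denotes the set of Rademacher sums $X=\sum_{i=1}^na_i\varepsilon_i$ where $a_1\geq a_2\geq\dots\geq a_n>0$ are real constants with $a_1^2+\dots+a_n^2=1$ (i.e. $\mathrm{Var}(X)=1$), and the $\varepsilon_i$ are independent random signs uniformly distributed on $\{-1,+1\}$. *)

(* Defs.v *)
From HB Require Import structures.
From mathcomp Require Import all_boot all_order all_algebra.
From mathcomp Require Import all_classical all_reals all_analysis.

Set Implicit Arguments.
Unset Strict Implicit.
Unset Printing Implicit Defensive.

Import Order.TTheory GRing.Theory Num.Theory.
Import numFieldNormedType.Exports.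

Local Open Scope classical_set_scope.
Local Open Scope ring_scope.

Definition rademacher (R : realType) (d : measure_display)
    (T : measurableType d) (P : probability T R) (e : {RV P >-> R}) : Prop :=
  P (e @^-1` [set 1]) = (2^-1)%:E /\ P (e @^-1` [set -1]) = (2^-1)%:E.

Definition mutually_independent (R : realType) (d : measure_display)
    (T : measurableType d) (P : probability T R) (I : finType)
    (X : I -> {RV P >-> R}) : Prop :=
  forall (J : {set I}) (B : I -> set R),
    (forall i, i \in J -> measurable (B i)) ->
    P (\bigcap_(i in [set` J]) (X i @^-1` B i)) =
    (\prod_(i in J) P (X i @^-1` B i))%E.

Definition unit_variance_coefs (R : realType) (n : nat) (a : 'I_n -> R) : Prop :=
  [/\ forall i j : 'I_n, (i <= j)%N -> a j <= a i,
      forall i, 0 < a i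
    & \sum_(i < n) a i ^+ 2 = 1].

Definition rademacher_sum (R : realType) (d : measure_display)
    (T : measurableType d) (P : probability T R) (n : nat)
    (a : 'I_n -> R) (e : 'I_n -> {RV P >-> R}) : T -> R :=
  fun t => \sum_(i < n) a i * e i t.

(* Main.v *)
Require Import Defs.
From HB Require Import structures.
From mathcomp Require Import all_boot all_order all_algebra.
From mathcomp Require Import all_classical all_reals all_analysis.
From mathcomp Require Import zify ring lra.

Set Implicit Arguments.
Unset Strict Implicit.
Unset Printing Implicit Defensive.

Import Order.TTheory GRing.Theory Num.Theory.
Import numFieldNormedType.Exports.

Local Open Scope classical_set_scope.
Local Open Scope ring_scope.

(** Scale so that the squares of the coefficients sum to 7; the claim becomes
    P(|X| < 1) <= 1/2.  Two terms a, b of X can be merged into a single one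
    that equals a + b or a - b with probability 1/2 each.  One term >= 1 forces
    P(|X| < 1) <= 1/2, and three such terms force P(|X| < 1) <= 3/8, since
    an antichain in the cube {-1,1}^3 has at most three elements.  If the
    largest term is < 1, let rho be the sum of the squares of all terms but
    the seven largest.
    - If the eighth term is >= 1/2, merging the first eight terms in pairs
      suffices.
    - If rho <= 7/16, the seven largest terms a_i satisfy
      D = sum (1 - a_i) <= sqrt (rho / 7).  Let Z be the sum of the other
      terms.  By induction P(|Z| < D) <= 1/2, while merging bounds
      P(|X| < 1 given Z) by 35/64 in general and by 7/16 when |Z| >= D.
    - Otherwise bound the indicator of (-1, 1) by a trigonometric polynomial
      in x with frequencies k * 7/10, k <= 5.  Its expectation is controlled
      by |cos x| <= exp (- x^2 / 2): the high frequencies are damped by rho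
      alone, because all the terms that it accounts for are < 1/2. *)

Local Ltac perm_by_count := clear; apply/permP => ? /=; lia.

(** * Averages over signs *)

Section SignAverage.
Variable R : realFieldType.
Implicit Types (l m : seq R) (g h : R -> R) (a b c u x : R).

(* E[g (u + X)], where X is the Rademacher sum with coefficients l. *)
Fixpoint sign_avg l g u : R :=
  if l is a :: l' then (sign_avg l' g (u + a) + sign_avg l' g (u - a)) / 2
  else g u.

Lemma sign_avg_le l g h u :
  (forall x, g x <= h x) -> sign_avg l g u <= sign_avg l h u.
Proof.
move=> gh; elim: l u => [|a l IH] u //=.
by have := IH (u + a); have := IH (u - a); lra.
Qed.

Lemma eq_sign_avg l g h u : g =1 h -> sign_avg l g u = sign_avg l h u.
Proof. by move=> gh; elim: l u => [|a l IH] u //=; rewrite !IH. Qed.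

Lemma sign_avg_const l c u : sign_avg l (fun=> c) u = c.
Proof. by elim: l u => [|a l IH] u //=; rewrite !IH; lra. Qed.

Lemma sign_avg_le_const l g c u :
  (forall x, g x <= c) -> sign_avg l g u <= c.
Proof. by move=> gc; rewrite -(sign_avg_const l c u); apply: sign_avg_le. Qed.

Lemma sign_avgD l g h u :
  sign_avg l (fun x => g x + h x) u = sign_avg l g u + sign_avg l h u.
Proof. by elim: l u => [|a l IH] u //=; rewrite !IH; lra. Qed.

Lemma sign_avgZ l c g u :
  sign_avg l (fun x => c * g x) u = c * sign_avg l g u.
Proof. by elim: l u => [|a l IH] u //=; rewrite !IH; ring. Qed.

Lemma sign_avg_cat l m g u :
  sign_avg (l ++ m) g u = sign_avg l (sign_avg m g) u.
Proof. by elim: l u => [|a l IH] u //=; rewrite !IH. Qed.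

Lemma sign_avg_cons a l g u :
  sign_avg (a :: l) g u = sign_avg l (sign_avg [:: a] g) u.
Proof.
elim: l u => [|b l IH] u //=; move: (IH (u + b)) (IH (u - b)) => /= <- <-.
by rewrite [u + a + b]addrAC [u - a + b]addrAC [u + a - b]addrAC
  [u - a - b]addrAC; lra.
Qed.

Lemma sign_avg_catC l m g u : sign_avg (l ++ m) g u = sign_avg (m ++ l) g u.
Proof.
elim: l m g u => [|a l IH] m g u; first by rewrite cats0.
rewrite cat_cons sign_avg_cons IH !sign_avg_cat.
by apply: eq_sign_avg => x; rewrite -sign_avg_cons.
Qed.

Lemma sign_avg_perm l m g u :
  perm_eq l m -> sign_avg l g u = sign_avg m g u.
Proof.
elim: l m g u => [|a l IH] m g u lm.
  by have /nilP -> : nilp m by rewrite /nilp -(perm_size lm).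
have /splitPr am : a \in m by rewrite -(perm_mem lm) mem_head.
case: am lm => p q lm.
rewrite (sign_avg_catC p) cat_cons (sign_avg_cons a l) (sign_avg_cons a (q ++ p)).
apply: IH; rewrite -(perm_cons a) (perm_trans lm) //.
by rewrite -cat_cons perm_catC.
Qed.

Lemma sign_avg_subseq m l g c u : subseq m l ->
  (forall x, sign_avg m g x <= c) -> sign_avg l g u <= c.
Proof.
elim: l m g u => [|a l IH] m g u.
  by rewrite subseq0 => /eqP -> /(_ u).
case: m => [|b m]; first by move=> _; apply: sign_avg_le_const.
move=> + mc; rewrite [subseq _ _]/=; case: (b =P a) => [ba|_] sml.
  rewrite sign_avg_cons; apply: IH sml _ => x.
  by rewrite -sign_avg_cons -ba.
rewrite /=.
have := IH _ g (u + a) sml mc; have := IH _ g (u - a) sml mc; lra.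
Qed.

Lemma sign_avg_even l g u : (forall x, g (- x) = g x) ->
  sign_avg l g (- u) = sign_avg l g u.
Proof.
move=> ge; elim: l u => [|a l IH] u //=.
have -> : - u + a = - (u - a) by ring.
by rewrite -opprD !IH addrC.
Qed.

Lemma sign_avg_scale l g c u :
  sign_avg [seq c * a | a <- l] g (c * u) = sign_avg l (fun x => g (c * x)) u.
Proof.
by elim: l u => [|a l IH] u //=; rewrite -mulrDr -mulrBr !IH.
Qed.

(** Given the product of their two signs, the terms with coefficients [a] and [b] act as a single
    term [a + b] or [a - b] carrying a fair sign. *)
Lemma sign_avg_merge a b l g u :
  sign_avg (a :: b :: l) g u =
  (sign_avg (a + b :: l) g u + sign_avg (a - b :: l) g u) / 2.
Proof.
rewrite /= !opprD opprK !addrA.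
by lra.
Qed.

Lemma sign_avg_merge3 a1 a2 a3 a4 a5 a6 l g u :
  sign_avg [:: a1, a2, a3, a4, a5, a6 & l] g u =
  (  (sign_avg [:: a1 + a2, a3 + a4, a5 + a6 & l] g u
    + sign_avg [:: a1 + a2, a3 + a4, a5 - a6 & l] g u
    + sign_avg [:: a1 + a2, a3 - a4, a5 + a6 & l] g u
    + sign_avg [:: a1 + a2, a3 - a4, a5 - a6 & l] g u)
   + (sign_avg [:: a1 - a2, a3 + a4, a5 + a6 & l] g u
    + sign_avg [:: a1 - a2, a3 + a4, a5 - a6 & l] g u
    + sign_avg [:: a1 - a2, a3 - a4, a5 + a6 & l] g u
    + sign_avg [:: a1 - a2, a3 - a4, a5 - a6 & l] g u)) / 8.
Proof.
rewrite sign_avg_merge.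
have mrg b v : sign_avg [:: b, a3, a4, a5, a6 & l] g v =
   (sign_avg [:: b, a3 + a4, a5 + a6 & l] g v
    + sign_avg [:: b, a3 + a4, a5 - a6 & l] g v
    + sign_avg [:: b, a3 - a4, a5 + a6 & l] g v
    + sign_avg [:: b, a3 - a4, a5 - a6 & l] g v) / 4.
  rewrite (sign_avg_perm (m := [:: a3, a4, b, a5, a6 & l])); last first.
    perm_by_count.
  rewrite sign_avg_merge.
  have sw c w : sign_avg [:: c, b, a5, a6 & l] g w =
     (sign_avg [:: b, c, a5 + a6 & l] g w
     + sign_avg [:: b, c, a5 - a6 & l] g w) / 2.
    rewrite (sign_avg_perm (m := [:: a5, a6, b, c & l])); last first.
      perm_by_count.
    rewrite sign_avg_merge; congr ((_ + _) / 2);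
      by apply: sign_avg_perm; perm_by_count.
  by rewrite !sw; lra.
by rewrite !mrg; lra.
Qed.

(** * The indicator of (-1, 1) and coefficients that are at least 1 *)

Definition in_unit x : R := (`|x| < 1)%R%:R.

Lemma in_unit_ge0 x : 0 <= in_unit x. Proof. exact: ler0n. Qed.
Lemma in_unit_le1 x : in_unit x <= 1. Proof. by rewrite lern1 leq_b1. Qed.

Lemma in_unitN x : in_unit (- x) = in_unit x.
Proof. by rewrite /in_unit normrN. Qed.

Lemma in_unit_sep x y : 2 <= y - x -> in_unit x + in_unit y <= 1.
Proof.
move=> xy; rewrite /in_unit !ltr_norml.
case: (boolP (-1 < x < 1)) => [/andP[? ?]|_];
  case: (boolP (-1 < y < 1)) => [/andP[? ?]|_] //=; lra.
Qed.

Lemma sign_avg_one_large s u : 1 <= s -> sign_avg [:: s] in_unit u <= 2^-1.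
Proof.
move=> s1 /=; have := @in_unit_sep (u - s) (u + s).
by move=> /(_ ltac:(lra)); lra.
Qed.

(* The cube {-1,1}^3 is covered by three chains along which the sum increases
   by at least 2 at every step, so each of them meets the interval at most once. *)
Lemma sign_avg_three_large s t r u : 1 <= s -> 1 <= t -> 1 <= r ->
  sign_avg [:: s; t; r] in_unit u <= 3 / 8.
Proof.
move=> s1 t1 r1 /=.
(* The first six inequalities are the pairs of the chain [---], [+--], [++-], [+++]; the last two
   are the chains [-+-], [-++] and [--+], [+-+]. *)
have := @in_unit_sep (u - s - t - r) (u + s - t - r) ltac:(lra).
have := @in_unit_sep (u - s - t - r) (u + s + t - r) ltac:(lra).
have := @in_unit_sep (u - s - t - r) (u + s + t + r) ltac:(lra).
have := @in_unit_sep (u + s - t - r) (u + s + t - r) ltac:(lra).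
have := @in_unit_sep (u + s - t - r) (u + s + t + r) ltac:(lra).
have := @in_unit_sep (u + s + t - r) (u + s + t + r) ltac:(lra).
have := @in_unit_sep (u - s + t - r) (u - s + t + r) ltac:(lra).
have := @in_unit_sep (u - s - t + r) (u + s - t + r) ltac:(lra).
have I01 v : in_unit v = 0 \/ in_unit v = 1.
  by rewrite /in_unit; case: (_ < _); [right|left].
case: (I01 (u - s - t - r)) => ->; case: (I01 (u + s - t - r)) => ->;
  case: (I01 (u + s + t - r)) => ->; lra.
Qed.

Lemma sign_avg_one_large_in s l u : 1 <= s -> s \in l ->
  sign_avg l in_unit u <= 2^-1.
Proof.
move=> s1 sl; apply: (@sign_avg_subseq [:: s]); first by rewrite sub1seq.
by move=> x; apply: sign_avg_one_large.
Qed.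

Lemma sign_avg_three_large_in s t r m l u : 1 <= s -> 1 <= t -> 1 <= r ->
  perm_eq l [:: s, t, r & m] -> sign_avg l in_unit u <= 3 / 8.
Proof.
move=> s1 t1 r1 /sign_avg_perm ->.
apply: (@sign_avg_subseq [:: s; t; r]); first exact: (prefix_subseq [:: _; _; _]).
by move=> x; apply: sign_avg_three_large.
Qed.

Lemma sign_avg_far l u : 1 + \sum_(a <- l) `|a| <= `|u| ->
  sign_avg l in_unit u = 0.
Proof.
elim: l u => [|a l IH] u /=.
  by rewrite big_nil addr0 /in_unit leNgt => /negbTE ->.
rewrite big_cons => au; rewrite !IH ?addr0 ?mul0r //.
  by have := ler_normB u a; have := lerB_normD u (-a); rewrite normrN; lra.
by have := lerB_normD u a; lra.
Qed.

Lemma sign_avg_in_unit_le1 l u : sign_avg l in_unit u <= 1.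
Proof. exact/sign_avg_le_const/in_unit_le1. Qed.

(* The number of merged pairs that are >= 1 is binomial: the bound 1 is used
   with weight 1/16, 1/2 with weight 10/16 and 3/8 with weight 5/16. *)
Lemma sign_avg_eight_large a1 a2 a3 a4 a5 a6 a7 a8 l u :
  2^-1 <= a1 -> 2^-1 <= a2 -> 2^-1 <= a3 -> 2^-1 <= a4 ->
  2^-1 <= a5 -> 2^-1 <= a6 -> 2^-1 <= a7 -> 2^-1 <= a8 ->
  sign_avg [:: a1, a2, a3, a4, a5, a6, a7, a8 & l] in_unit u <= 2^-1.
Proof.
move=> h1 h2 h3 h4 h5 h6 h7 h8.
have s1 : 1 <= a1 + a2 by lra.
have s2 : 1 <= a3 + a4 by lra.
have s3 : 1 <= a5 + a6 by lra.
have s4 : 1 <= a7 + a8 by lra.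
have split x y z : sign_avg [:: x, y, z, a7, a8 & l] in_unit u =
    (sign_avg [:: x, y, z, a7 + a8 & l] in_unit u
     + sign_avg [:: x, y, z, a7 - a8 & l] in_unit u) / 2.
  rewrite (sign_avg_perm (m := [:: a7, a8, x, y, z & l])); last first.
    perm_by_count.
  rewrite sign_avg_merge; congr ((_ + _) / 2);
    by apply: sign_avg_perm; perm_by_count.
pose d1 := a1 - a2; pose d2 := a3 - a4; pose d3 := a5 - a6; pose d4 := a7 - a8.
rewrite sign_avg_merge3 !split -/d1 -/d2 -/d3 -/d4.
have three s t r x m : 1 <= s -> 1 <= t -> 1 <= r ->
    perm_eq m [:: s, t, r, x & l] -> sign_avg m in_unit u <= 3 / 8.
  exact: sign_avg_three_large_in.
(* In these names, the letter at each position tells whether that pair was merged into its sum ([S])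
   or its difference ([d]). *)
have SSSS := three _ _ _ (a7 + a8) [:: a1 + a2, a3 + a4, a5 + a6, a7 + a8 & l]
  s1 s2 s3 ltac:(perm_by_count).
have SSSd := three _ _ _ d4 [:: a1 + a2, a3 + a4, a5 + a6, d4 & l]
  s1 s2 s3 ltac:(perm_by_count).
have SSdS := three _ _ _ d3 [:: a1 + a2, a3 + a4, d3, a7 + a8 & l]
  s1 s2 s4 ltac:(perm_by_count).
have SdSS := three _ _ _ d2 [:: a1 + a2, d2, a5 + a6, a7 + a8 & l]
  s1 s3 s4 ltac:(perm_by_count).
have dSSS := three _ _ _ d1 [:: d1, a3 + a4, a5 + a6, a7 + a8 & l]
  s2 s3 s4 ltac:(perm_by_count).
have one s m : 1 <= s -> s \in m -> sign_avg m in_unit u <= 2^-1.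
  by move=> ? ?; apply: (@sign_avg_one_large_in s).
have SSdd := one _ [:: a1 + a2, a3 + a4, d3, d4 & l] s1 ltac:(by rewrite !inE eqxx).
have SdSd := one _ [:: a1 + a2, d2, a5 + a6, d4 & l] s1 ltac:(by rewrite !inE eqxx).
have SddS := one _ [:: a1 + a2, d2, d3, a7 + a8 & l] s1 ltac:(by rewrite !inE eqxx).
have Sddd := one _ [:: a1 + a2, d2, d3, d4 & l] s1 ltac:(by rewrite !inE eqxx).
have dSSd := one _ [:: d1, a3 + a4, a5 + a6, d4 & l] s2
  ltac:(by rewrite !inE eqxx ?orbT).
have dSdS := one _ [:: d1, a3 + a4, d3, a7 + a8 & l] s2
  ltac:(by rewrite !inE eqxx ?orbT).
have dSdd := one _ [:: d1, a3 + a4, d3, d4 & l] s2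
  ltac:(by rewrite !inE eqxx ?orbT).
have ddSS := one _ [:: d1, d2, a5 + a6, a7 + a8 & l] s3
  ltac:(by rewrite !inE eqxx ?orbT).
have ddSd := one _ [:: d1, d2, a5 + a6, d4 & l] s3
  ltac:(by rewrite !inE eqxx ?orbT).
have dddS := one _ [:: d1, d2, d3, a7 + a8 & l] s4
  ltac:(by rewrite !inE eqxx ?orbT).
have dddd := sign_avg_in_unit_le1 [:: d1, d2, d3, d4 & l] u.
lra.
Qed.

(** * Seven coefficients close to 1 *)

(** The indicator is even, so the shift [z] may be given a random sign and counted as one more
    coefficient. *)
Lemma sign_avg_in_unitE l z : sign_avg l in_unit z = sign_avg (z :: l) in_unit 0.
Proof. by rewrite /= add0r sub0r (sign_avg_even _ _ in_unitN); lra. Qed.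

Lemma sign_avg_far2 (d d' v : R) : 1 + (`|d| + `|d'|) <= `|v| ->
  sign_avg [:: d; d'] in_unit v = 0.
Proof.
by move=> dv; apply: sign_avg_far; rewrite !big_cons big_nil addr0.
Qed.

(** The sum of any two coefficients is at least 1. Of the eight ways to merge three pairs, one has
    three sums (3/8), six have one or two (1/2) and one has none (1): the mean is 35/64. *)
Lemma sign_avg_seven_near_one (a1 a2 a3 a4 a5 a6 a7 : R) z :
  a1 <= 1 -> a2 <= 1 -> a3 <= 1 -> a4 <= 1 -> a5 <= 1 -> a6 <= 1 -> a7 <= 1 ->
  (1 - a1) + (1 - a2) + (1 - a3) + (1 - a4) + (1 - a5) + (1 - a6)
    + (1 - a7) <= 4^-1 ->
  sign_avg [:: a1; a2; a3; a4; a5; a6; a7] in_unit z <= 35 / 64.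
Proof.
move=> h1 h2 h3 h4 h5 h6 h7 D_le.
have s12 : 1 <= a1 + a2 by lra.
have s34 : 1 <= a3 + a4 by lra.
have s56 : 1 <= a5 + a6 by lra.
rewrite sign_avg_merge3.
pose d1 := a1 - a2; pose d2 := a3 - a4; pose d3 := a5 - a6.
rewrite -/d1 -/d2 -/d3.
have SSS := @sign_avg_three_large_in _ _ _ [:: a7]
  [:: a1 + a2; a3 + a4; a5 + a6; a7] z s12 s34 s56 (perm_refl _).
have one s m : 1 <= s -> s \in m -> sign_avg m in_unit z <= 2^-1.
  by move=> ? ?; apply: (@sign_avg_one_large_in s).
have SSd := one _ [:: a1 + a2; a3 + a4; d3; a7] s12 ltac:(by rewrite !inE eqxx).
have SdS := one _ [:: a1 + a2; d2; a5 + a6; a7] s12 ltac:(by rewrite !inE eqxx).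
have Sdd := one _ [:: a1 + a2; d2; d3; a7] s12 ltac:(by rewrite !inE eqxx).
have dSS := one _ [:: d1; a3 + a4; a5 + a6; a7] s34
  ltac:(by rewrite !inE eqxx ?orbT).
have dSd := one _ [:: d1; a3 + a4; d3; a7] s34
  ltac:(by rewrite !inE eqxx ?orbT).
have ddS := one _ [:: d1; d2; a5 + a6; a7] s56
  ltac:(by rewrite !inE eqxx ?orbT).
have ddd := sign_avg_in_unit_le1 [:: d1; d2; d3; a7] z.
lra.
Qed.

(* If z >= 1, then z is one more large term; if D <= z < 1, then a7 and z
   together push most sign patterns with at most one large pair outside. *)
Lemma sign_avg_seven_near_one_shift (a1 a2 a3 a4 a5 a6 a7 : R) z :
  a1 <= 1 -> a2 <= 1 -> a3 <= 1 -> a4 <= 1 -> a5 <= 1 -> a6 <= 1 -> a7 <= 1 ->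
  (1 - a1) + (1 - a2) + (1 - a3) + (1 - a4) + (1 - a5) + (1 - a6)
    + (1 - a7) <= 4^-1 ->
  (1 - a1) + (1 - a2) + (1 - a3) + (1 - a4) + (1 - a5) + (1 - a6)
    + (1 - a7) <= `|z| ->
  sign_avg [:: a1; a2; a3; a4; a5; a6; a7] in_unit z <= 7 / 16.
Proof.
move=> h1 h2 h3 h4 h5 h6 h7 D_le.
have s12 : 1 <= a1 + a2 by lra.
have s34 : 1 <= a3 + a4 by lra.
have s56 : 1 <= a5 + a6 by lra.
have diff_le a b : a <= 1 -> b <= 1 -> `|a - b| <= (1 - a) + (1 - b).
  by move=> ? ?; rewrite ler_norml; apply/andP; split; lra.
have d12 := diff_le _ _ h1 h2; have d34 := diff_le _ _ h3 h4.
have d56 := diff_le _ _ h5 h6; move=> {diff_le}.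
wlog z0 : z / 0 <= z => [wl|].
  case: (lerP 0 z) => [/wl//|/ltW z0]; rewrite -[z]opprK normrN => Dz.
  rewrite (sign_avg_even _ _ in_unitN); apply: wl => //.
  by rewrite oppr_ge0.
rewrite ger0_norm // => Dz; rewrite sign_avg_merge3.
pose d1 := a1 - a2; pose d2 := a3 - a4; pose d3 := a5 - a6.
rewrite -/d1 -/d2 -/d3.
have one s m : 1 <= s -> s \in m -> sign_avg m in_unit z <= 2^-1.
  by move=> ? ?; apply: (@sign_avg_one_large_in s).
have SSS := @sign_avg_three_large_in _ _ _ [:: a7]
  [:: a1 + a2; a3 + a4; a5 + a6; a7] z s12 s34 s56 (perm_refl _).
(* For [z >= 1], the four patterns with at least two sums cost 3/8 each and the other four 1/2 each,
   which is 7/16 on average. *)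
case: (lerP 1 z) => z1.
  have three s t x y m : 1 <= s -> 1 <= t ->
      perm_eq m [:: s; t; x; y] -> sign_avg m in_unit z <= 3 / 8.
    move=> ? ? pm; rewrite sign_avg_in_unitE.
    by apply: (@sign_avg_three_large_in z s t [:: x; y]); rewrite // perm_cons.
  have oneZ m : sign_avg m in_unit z <= 2^-1.
    by rewrite sign_avg_in_unitE; apply: (@sign_avg_one_large_in z);
      rewrite // mem_head.
  have SSd := three _ _ d3 a7 [:: a1 + a2; a3 + a4; d3; a7] s12 s34
    (perm_refl _).
  have SdS := three _ _ d2 a7 [:: a1 + a2; d2; a5 + a6; a7] s12 s56
    ltac:(perm_by_count).
  have dSS := three _ _ d1 a7 [:: d1; a3 + a4; a5 + a6; a7] s34 s56
    ltac:(perm_by_count).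
  have := oneZ [:: a1 + a2; d2; d3; a7]; have := oneZ [:: d1; a3 + a4; d3; a7].
  have := oneZ [:: d1; d2; a5 + a6; a7]; have := oneZ [:: d1; d2; d3; a7].
  lra.
have SSd := one _ [:: a1 + a2; a3 + a4; d3; a7] s12 ltac:(by rewrite !inE eqxx).
have SdS := one _ [:: a1 + a2; d2; a5 + a6; a7] s12 ltac:(by rewrite !inE eqxx).
have dSS := one _ [:: d1; a3 + a4; a5 + a6; a7] s34
  ltac:(by rewrite !inE eqxx ?orbT).
(* With a single merged sum [s], three of the four sign choices for [s] and [a7] lead too far out
   for [d] and [d'] to bring the total back; only [z - s + a7] is left. *)
have quarter s d d' m : perm_eq m [:: s; a7; d; d'] ->
    1 + (`|d| + `|d'|) <= s + a7 - z -> 1 + (`|d| + `|d'|) <= z + s - a7 ->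
    sign_avg m in_unit z <= 4^-1.
  move=> /sign_avg_perm ->.
  rewrite -[[:: s; a7; d; d']]/([:: s; a7] ++ [:: d; d']) sign_avg_cat.
  set g := sign_avg [:: d; d'] in_unit => far1 far2 /=.
  have -> : g (z + s + a7) = 0.
    by apply: sign_avg_far2; apply: le_trans (ler_norm _); lra.
  have -> : g (z + s - a7) = 0.
    by apply: sign_avg_far2; apply: le_trans (ler_norm _); lra.
  have -> : g (z - s - a7) = 0.
    by apply: sign_avg_far2; rewrite -[leRHS]normrN; apply: le_trans (ler_norm _);
      lra.
  by have := sign_avg_in_unit_le1 [:: d; d'] (z - s + a7); rewrite -/g; lra.
have Sdd := @quarter (a1 + a2) d2 d3 [:: a1 + a2; d2; d3; a7]
  ltac:(perm_by_count) ltac:(rewrite /d2 /d3; lra)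
  ltac:(rewrite /d2 /d3; lra).
have dSd := @quarter (a3 + a4) d1 d3 [:: d1; a3 + a4; d3; a7]
  ltac:(perm_by_count) ltac:(rewrite /d1 /d3; lra)
  ltac:(rewrite /d1 /d3; lra).
have ddS := @quarter (a5 + a6) d1 d2 [:: d1; d2; a5 + a6; a7]
  ltac:(perm_by_count) ltac:(rewrite /d1 /d2; lra)
  ltac:(rewrite /d1 /d2; lra).
(* Each difference is at most the joint deficiency of its pair, so [D <= z] puts [z + a7] out of
   reach of (-1, 1), where D sums all seven deficiencies [1 - ai]. *)
have ddd : sign_avg [:: d1; d2; d3; a7] in_unit z <= 2^-1.
  rewrite (sign_avg_perm (m := [:: a7; d1; d2; d3])); last first.
    perm_by_count.
  rewrite -[[:: a7; _; _; _]]/([:: a7] ++ [:: d1; d2; d3]) sign_avg_cat.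
  set g := sign_avg [:: d1; d2; d3] in_unit => /=.
  have -> : g (z + a7) = 0.
    apply: sign_avg_far; apply: le_trans (ler_norm _).
    by rewrite !big_cons big_nil /d1 /d2 /d3; lra.
  by have := sign_avg_in_unit_le1 [:: d1; d2; d3] (z - a7); rewrite -/g; lra.
lra.
Qed.

End SignAverage.

Arguments in_unit {R} x.

(** * The Fourier bound *)

Section Trigonometry.
Variable R : realType.
Implicit Types x y : R.

(** * Taylor bounds and a Gaussian bound for the cosine *)

Lemma le_of_derive_ge0 (f df : R -> R) : (forall x, is_derive x 1 f (df x)) ->
  (forall x, 0 <= x -> 0 <= df x) -> forall x, 0 <= x -> f 0 <= f x.
Proof.
move=> fdf df0 x x0.
have cf : {within `[0, x], continuous f}.
  by apply: derivable_within_continuous => y _; have [] := fdf y.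
have [c] := MVT_segment x0 (fun y _ => fdf y) cf.
rewrite in_itv /= => /andP[c0 _] fE; rewrite -subr_ge0 fE subr0.
by rewrite mulr_ge0 ?df0.
Qed.

(** First of four Taylor bounds, each obtained from the previous one by integration from 0, starting
    at [cos <= 1]. *)
Lemma sin_le x : 0 <= x -> sin x <= x.
Proof.
move=> x0; pose f y : R := y - sin y.
have df y : is_derive y 1 f (1 - cos y) by apply: is_deriveB.
have := le_of_derive_ge0 df _ x0; rewrite /f sin0 subr0 subr_ge0; apply.
by move=> y _; rewrite subr_ge0 cos_le1.
Qed.

Lemma cos_ge_quadratic x : 0 <= x -> 1 - x ^+ 2 / 2 <= cos x.
Proof.
move=> x0; pose f y : R := cos y + y ^+ 2 / 2.
have df y : is_derive y 1 f (y - sin y).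
  by rewrite /f; apply: is_derive_eq; rewrite /GRing.scale /=; lra.
have := le_of_derive_ge0 df _ x0.
rewrite /f cos0 expr0n mul0r addr0 lerBlDr; apply.
by move=> y y0; rewrite subr_ge0 sin_le.
Qed.

Lemma sin_ge_cubic x : 0 <= x -> x - x ^+ 3 / 6 <= sin x.
Proof.
move=> x0; pose f y : R := sin y - y + y ^+ 3 / 6.
have df y : is_derive y 1 f (cos y - 1 + y ^+ 2 / 2).
  by rewrite /f; apply: is_derive_eq; rewrite /GRing.scale /=; lra.
have := le_of_derive_ge0 df _ x0.
rewrite /f sin0 expr0n mul0r addr0 subr0 => h.
suff : 0 <= sin x - x + x ^+ 3 / 6 by lra.
by apply: h => y y0; have := cos_ge_quadratic y0; lra.
Qed.

Lemma cos_le_quartic x : 0 <= x -> cos x <= 1 - x ^+ 2 / 2 + x ^+ 4 / 24.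
Proof.
move=> x0; pose f y : R := 1 - y ^+ 2 / 2 + y ^+ 4 / 24 - cos y.
have df y : is_derive y 1 f (- y + y ^+ 3 / 6 + sin y).
  by rewrite /f; apply: is_derive_eq; rewrite /GRing.scale /=; lra.
have := le_of_derive_ge0 df _ x0.
rewrite /f cos0 !expr0n /= !mul0r addr0 subr0 subrr subr_ge0; apply.
by move=> y y0; have := sin_ge_cubic y0; lra.
Qed.

Lemma cos_double x : cos (2 * x) = 2 * cos x ^+ 2 - 1.
Proof. by rewrite mulr_natl cos_mulr2n -mulr_natl. Qed.

Lemma cos_recurrence n x :
  cos (n.+2%:R * x) = 2 * cos x * cos (n.+1%:R * x) - cos (n%:R * x).
Proof.
have -> : n.+2%:R * x = n.+1%:R * x + x by rewrite -!natr1; ring.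
have -> : n%:R * x = n.+1%:R * x - x by rewrite -!natr1; ring.
by rewrite !cosD cosN sinN; ring.
Qed.

(* 7/4 = 5 * (7/10) * (1/2) is the largest argument needed below. *)
Lemma norm_cos_le_expR x : `|x| <= 7 / 4 -> `|cos x| <= expR (- (x ^+ 2 / 2)).
Proof.
wlog x0 : x / 0 <= x => [wl|].
  case: (lerP 0 x) => [/wl//|/ltW x0] xle.
  rewrite -cosN -sqrrN; apply: wl; first by rewrite oppr_ge0.
  by rewrite normrN.
rewrite ger0_norm // => xle.
have xx : x ^+ 2 <= 49 / 16 by nra.
have sq : (1 - x ^+ 2 / 4) ^+ 2 <= expR (- (x ^+ 2 / 2)).
  have -> : - (x ^+ 2 / 2) = 2 * (- (x ^+ 2 / 4)) by lra.
  rewrite expRM_natl ler_pXn2r ?nnegrE ?expR_ge0 //; last by lra.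
  by have := expR_ge1Dx (- (x ^+ 2 / 4)); lra.
rewrite ler_norml; apply/andP; split; last first.
  apply: le_trans sq; have := cos_le_quartic x0; have := exprn_ge0 4 x0.
  have -> : (1 - x ^+ 2 / 4) ^+ 2 = 1 - x ^+ 2 / 2 + x ^+ 4 / 16 by field.
  lra.
(* As 7/4 exceeds pi/2, the cosine can be negative. A quadratic bound at [x / 4] and two angle
   doublings show that it remains small. *)
have c1 : - (196 / 1000) <= cos x.
  have c2 : 6344 / 10000 <= cos (x / 2).
    have c4 : 904 / 1000 <= cos (x / 4).
      by have := @cos_ge_quadratic (x / 4); lra.
    have -> : x / 2 = 2 * (x / 4) by lra.
    by move: (cos (x / 4)) c4 {xle xx x0 sq} (cos_double (x / 4)) => y y_ge ->; nra.
  have -> : x = 2 * (x / 2) by lra.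
  by move: (cos (x / 2)) c2 {xle xx x0 sq} (cos_double (x / 2)) => y y_ge ->; nra.
(* The bound exp (- y) >= 1 - y is too weak at y = x^2 / 2, which may exceed 1; it is used at y / 16
   and followed by four squarings. *)
suff : 196 / 1000 <= expR (- (x ^+ 2 / 2)) by lra.
have -> : - (x ^+ 2 / 2) = 16 * - (x ^+ 2 / 32) by lra.
rewrite expRM_natl.
have : 904 / 1000 <= expR (- (x ^+ 2 / 32)).
  by have := expR_ge1Dx (- (x ^+ 2 / 32)); lra.
move: (expR _) => q {xle xx x0 sq c1} q_ge.
rewrite (exprM q 2 8) (exprM _ 2 4) (exprM _ 2 2).
have q2 : 817 / 1000 <= q ^+ 2 by nra.
move: (q ^+ 2) q2 => r {q_ge} r_ge.
have r2 : 667 / 1000 <= r ^+ 2 by nra.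
move: (r ^+ 2) r2 => {r_ge} r r_ge.
have r2 : 444 / 1000 <= r ^+ 2 by nra.
move: (r ^+ 2) r2 => {r_ge} r r_ge.
by nra.
Qed.

(** The quadratic bound taken at 7/10 itself yields only 755/1000; taking it at [x / 4] and doubling
    the angle twice loses less. *)
Lemma cos_ge_near0 x : `|x| <= 7 / 10 -> 763 / 1000 <= cos x.
Proof.
wlog x0 : x / 0 <= x => [wl|].
  case: (lerP 0 x) => [/wl//|/ltW x0] xle.
  by rewrite -cosN; apply: wl; rewrite ?oppr_ge0 ?normrN.
rewrite ger0_norm // => xle.
have c4 : 64 / 65 <= cos (x / 4).
  by apply: le_trans (@cos_ge_quadratic (x / 4) _); [nra|lra].
have c2 : 9389 / 10000 <= cos (x / 2).
  have -> : x / 2 = 2 * (x / 4) by lra.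
  by move: (cos (x / 4)) c4 {xle x0} (cos_double (x / 4)) => y y_ge ->; nra.
have -> : x = 2 * (x / 2) by lra.
by move: (cos (x / 2)) c2 {xle x0 c4} (cos_double (x / 2)) => y y_ge ->; nra.
Qed.

(** * Numerical values of the exponential *)

Lemma expR_ge_pow32 x : 0 <= x -> (1 + x / 32) ^+ 32 <= expR x.
Proof.
move=> x0; have {2}-> : x = 32 * (x / 32) by lra.
rewrite expRM_natl ler_pXn2r ?nnegrE ?expR_ge0 ?expR_ge1Dx //.
by lra.
Qed.

Lemma expRN_le x c : 0 <= x -> 0 < c -> 1 <= c * (1 + x / 32) ^+ 32 ->
  expR (- x) <= c.
Proof.
move=> x0 c0 xc; rewrite expRN -div1r ler_pdivrMr ?expR_gt0 //.
by apply: le_trans xc _; rewrite ler_pM2l // expR_ge_pow32.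
Qed.

(** Certifies a 32nd power by five squarings, with room to round down after each so that the numbers
    stay short. *)
Lemma pow32_ge (q q2 q4 q8 q16 q32 : R) : 0 <= q -> 0 <= q2 -> 0 <= q4 ->
  0 <= q8 -> 0 <= q16 ->
  q2 <= q ^+ 2 -> q4 <= q2 ^+ 2 -> q8 <= q4 ^+ 2 -> q16 <= q8 ^+ 2 ->
  q32 <= q16 ^+ 2 -> q32 <= q ^+ 32.
Proof.
move=> h1 h2 h4 h8 h16 le2 le4 le8 le16 le32.
rewrite (exprM q 2 16) (exprM _ 2 8) (exprM _ 2 4) (exprM _ 2 2).
apply: le_trans le32 _; rewrite ler_pXn2r ?nnegrE ?exprn_ge0 //.
apply: le_trans le16 _; rewrite ler_pXn2r ?nnegrE ?exprn_ge0 //.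
apply: le_trans le8 _; rewrite ler_pXn2r ?nnegrE ?exprn_ge0 //.
by apply: le_trans le4 _; rewrite ler_pXn2r ?nnegrE ?exprn_ge0.
Qed.

(** The exponents here have the form (7k/10)^2 / 2 * V: 343/200 is k = 1, V = 7 and also k = 4, V =
    7/16; 343/50 is k = 2, V = 7; 267/100 rounds down k = 5, V = 7/16. *)
Lemma expRN_343_200_le : expR (- (343 / 200)) <= 19 / 100 :> R.
Proof.
apply: expRN_le; [lra|lra|].
suff : 529 / 100 <= (1 + 343 / 200 / 32) ^+ 32 :> R by lra.
apply: (@pow32_ge _ (111 / 100) (123 / 100 + 2 / 1000) (151 / 100 + 7 / 1000)
  (230 / 100 + 1 / 1000)); lra.
Qed.

Lemma expRN_343_50_le : expR (- (343 / 50)) <= 14 / 10000 :> R.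
Proof.
have -> : - (343 / 50) = 4 * (- (343 / 200)) :> R by lra.
rewrite expRM_natl; apply: (@le_trans _ _ ((19 / 100) ^+ 4)); last by lra.
by rewrite ler_pXn2r ?nnegrE ?expR_ge0 ?expRN_343_200_le //; lra.
Qed.

Lemma expRN_267_100_le : expR (- (267 / 100)) <= 83 / 1000 :> R.
Proof.
apply: expRN_le; [lra|lra|].
suff : 121 / 10 <= (1 + 267 / 100 / 32) ^+ 32 :> R by lra.
apply: (@pow32_ge _ (117 / 100) (136 / 100 + 8 / 1000) (187 / 100) (349 / 100)); lra.
Qed.

(** * Expectation of the trigonometric majorant *)

(** Product formula for the characteristic function: in the average of cos (c (u + a)) and cos (c (u
    - a)) the sine terms cancel. *)
Lemma sign_avg_cos (l : seq R) (c u : R) : sign_avg l (fun x => cos (c * x)) u =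
  cos (c * u) * \prod_(a <- l) cos (c * a).
Proof.
elim: l u => [|a l IH] u /=; first by rewrite big_nil mulr1.
by rewrite big_cons !IH mulrDr mulrBr !cosD cosN sinN; lra.
Qed.

Lemma norm_prod_cos_le (l : seq R) (c : R) : (forall a, a \in l -> `|c * a| <= 7 / 4) ->
  `|\prod_(a <- l) cos (c * a)| <= expR (- (c ^+ 2 / 2 * \sum_(a <- l) a ^+ 2)).
Proof.
elim: l => [|a l IH] al; first by rewrite !big_nil mulr0 oppr0 expR0 normr1.
rewrite !big_cons mulrDr opprD expRD normrM; apply: ler_pM => //.
  have -> : c ^+ 2 / 2 * a ^+ 2 = (c * a) ^+ 2 / 2 by ring.
  by apply: norm_cos_le_expR; apply: al; rewrite mem_head.
by apply: IH => b bl; apply: al; rewrite in_cons bl orbT.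
Qed.

Lemma norm_prod_cos_le1 (l : seq R) (c : R) : `|\prod_(a <- l) cos (c * a)| <= 1.
Proof.
elim: l => [|a l IH]; first by rewrite big_nil normr1.
by rewrite big_cons normrM mulr_ile1 ?cos_max.
Qed.

(* With y = cos (7/10 * x) this is a quintic in y (see majorantE).  Its only odd
   zero is at 6/5 > 1, so it is nonnegative on [-1, 1]; the two double zeros were
   chosen numerically so that it stays at least 1 on [cos (7/10), 1] while its
   expectation is below 1/2. *)
Let majorant x : R := 11 / 40 * (43 / 32 + (2 - 11 / 2304) * cos (1 * (7 / 10) * x)
  + 95 / 96 * cos (2 * (7 / 10) * x) + 1 / 768 * cos (3 * (7 / 10) * x)
  + (- 11 / 32) * cos (4 * (7 / 10) * x) + (- 5 / 16) * cos (5 * (7 / 10) * x)).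

Let majorantE x (y := cos (7 / 10 * x)) :
  majorant x = 11 / 40 * (6 - 5 * y) * (y ^+ 2 + 7 / 8 * y + 1 / 24) ^+ 2.
Proof.
rewrite /majorant -!(mulrA _ (7 / 10)).
(* The Chebyshev recurrence expresses the multiples 2 to 5 of the angle as polynomials in [y]. *)
have y2 := cos_recurrence 0 (7 / 10 * x); have y3 := cos_recurrence 1 (7 / 10 * x).
have y4 := cos_recurrence 2 (7 / 10 * x); have y5 := cos_recurrence 3 (7 / 10 * x).
rewrite mul1r mul0r cos0 -/y in y2; rewrite y2 mul1r -/y in y3.
rewrite y3 y2 -/y in y4; rewrite y4 y3 -/y in y5.
by rewrite y5 y4 y3 y2 mul1r -/y; field.
Qed.

Let majorant_ge0 x : 0 <= majorant x.
Proof.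
rewrite majorantE; apply: mulr_ge0; last exact: sqr_ge0.
by have := cos_le1 (7 / 10 * x); lra.
Qed.

Let quintic_ge1 (y : R) : 763 / 1000 <= y -> y <= 1 ->
  1 <= 11 / 40 * (6 - 5 * y) * (y ^+ 2 + 7 / 8 * y + 1 / 24) ^+ 2.
Proof.
move=> y_ge y_le; pose s := y - 763 / 1000.
have s0 : 0 <= s by rewrite /s; lra.
have s1 : s <= 237 / 1000 by rewrite /s; lra.
have -> : y = 763 / 1000 + s by rewrite /s; lra.
move: s s0 s1 {y_ge y_le} => s s0 s1.
(* Bounding the higher powers by multiples of [s] makes the claim linear. *)
have s2 : s ^+ 2 <= 237 / 1000 * s by nra.
have s3 : s ^+ 3 <= 57 / 1000 * s by rewrite exprS; nra.
have s4 : s ^+ 4 <= 14 / 1000 * s by rewrite exprS; nra.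
have s5 : s ^+ 5 <= 4 / 1000 * s by rewrite exprS; nra.
by lra.
Qed.

Let in_unit_le_majorant x : in_unit x <= majorant x.
Proof.
rewrite /in_unit; case: (ltrP `|x| 1) => [x1|_]; last exact: majorant_ge0.
rewrite majorantE; apply: quintic_ge1; last exact: cos_le1.
by apply: cos_ge_near0; rewrite normrM ger0_norm; lra.
Qed.

Lemma sign_avg_fourier (l m : seq R) : (forall a, a \in l -> `|a| <= 1) ->
  (forall a, a \in m -> `|a| <= 2^-1) ->
  \sum_(a <- l ++ m) a ^+ 2 = 7 -> 7 / 16 <= \sum_(a <- m) a ^+ 2 ->
  sign_avg (l ++ m) in_unit 0 <= 2^-1.
Proof.
move=> l1 m2 S7 rho.
apply: le_trans (sign_avg_le (l ++ m) 0 in_unit_le_majorant) _.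
pose F c := \prod_(a <- l ++ m) cos (c * (7 / 10) * a).
have -> : sign_avg (l ++ m) majorant 0 = 11 / 40 * (43 / 32
    + (2 - 11 / 2304) * F 1 + 95 / 96 * F 2 + 1 / 768 * F 3
    + (- 11 / 32) * F 4 + (- 5 / 16) * F 5).
  have avg_cos c : sign_avg (l ++ m) (fun x => cos (c * x)) 0 =
      \prod_(a <- l ++ m) cos (c * a) by rewrite sign_avg_cos mulr0 cos0 mul1r.
  by rewrite /majorant sign_avgZ !sign_avgD !sign_avgZ sign_avg_const !avg_cos.
have lm1 a : a \in l ++ m -> `|a| <= 1.
  by rewrite mem_cat => /orP[/l1 //|/m2 a2]; lra.
(* Up to [c = 2] every argument is at most 7/5, within the range of the Gaussian bound, so the whole
   sum of squares 7 contributes. *)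
have low c : 0 <= c <= 2 -> F c <= expR (- (c ^+ 2 * (343 / 200))).
  move=> c02; apply: le_trans (ler_norm _) _.
  apply: le_trans (norm_prod_cos_le _) _ => [a /lm1 a1|].
    by rewrite normrM ger0_norm; nra.
  by rewrite S7 ler_expR; lra.
(* Up to [c = 5] this range is guaranteed only for coefficients at most 1/2: factors from [l] are
   bounded by 1, and [m] contributes at least 7/16. *)
have high c : 0 <= c <= 5 -> `|F c| <= expR (- (c ^+ 2 * (343 / 3200))).
  move=> c05; rewrite /F big_cat normrM /=.
  apply: le_trans (ler_piMl (normr_ge0 _) (norm_prod_cos_le1 _ _)) _.
  apply: le_trans (norm_prod_cos_le _) _ => [a /m2 a2|].
    by rewrite normrM ger0_norm; nra.
  rewrite ler_expR; nra.
have F1 : F 1 <= 19 / 100.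
  by apply: le_trans (low 1 _) _; [lra|rewrite expr1n mul1r expRN_343_200_le].
have F2 : F 2 <= 14 / 10000.
  apply: le_trans (low 2 _) _; first lra.
  have -> : 2 ^+ 2 * (343 / 200) = 343 / 50 :> R by lra.
  exact: expRN_343_50_le.
(* The weight 1/768 is small enough for the trivial bound. *)
have F3 : `|F 3| <= 1 by exact: norm_prod_cos_le1.
have F4 : `|F 4| <= 19 / 100.
  apply: le_trans (high 4 _) _; first lra.
  have -> : 4 ^+ 2 * (343 / 3200) = 343 / 200 :> R by lra.
  exact: expRN_343_200_le.
have F5 : `|F 5| <= 83 / 1000.
  apply: le_trans (high 5 _) _; first lra.
  by apply: le_trans expRN_267_100_le; rewrite ler_expR; lra.
move: F3 F4 F5; rewrite !ler_norml => /andP[_ F3] /andP[F4 _] /andP[F5 _].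
lra.
Qed.

End Trigonometry.

(** * The main bound *)

Section HalfBound.
Variable R : realType.
Implicit Types (l : seq R) (a : R).

Lemma sum_sqr_le_size l : (forall a, a \in l -> `|a| <= 1) ->
  \sum_(a <- l) a ^+ 2 <= (size l)%:R.
Proof.
elim: l => [|a l IH] l1 /=; first by rewrite big_nil.
rewrite big_cons -natr1 addrC; apply: lerD.
  by apply: IH => b bl; apply: l1; rewrite in_cons bl orbT.
by rewrite -real_normK ?num_real // expr_le1 // l1 ?mem_head.
Qed.

(** Condition on the sum z over [m], with D the total deficiency of the seven large coefficients:
    the bound is 35/64 = 7/16 + 7/64 if |z| < D, and 7/16 otherwise. Scaling sends |z| < D into (-1,
    1), so the hypothesis on [m] gives 7/16 + 7/128 < 1/2. *)
Lemma sign_avg_near_one (a1 a2 a3 a4 a5 a6 a7 : R) (m : seq R)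
    (rho := \sum_(a <- m) a ^+ 2) :
  0 < a1 < 1 -> 0 < a2 < 1 -> 0 < a3 < 1 -> 0 < a4 < 1 -> 0 < a5 < 1 ->
  0 < a6 < 1 -> 0 < a7 < 1 ->
  a1 ^+ 2 + a2 ^+ 2 + a3 ^+ 2 + a4 ^+ 2 + a5 ^+ 2 + a6 ^+ 2 + a7 ^+ 2 + rho
    = 7 ->
  0 < rho -> rho <= 7 / 16 ->
  sign_avg [seq Num.sqrt (7 / rho) * a | a <- m] in_unit 0 <= 2^-1 ->
  sign_avg [:: a1, a2, a3, a4, a5, a6, a7 & m] in_unit 0 <= 2^-1.
Proof.
move=> /andP[p1 q1] /andP[p2 q2] /andP[p3 q3] /andP[p4 q4] /andP[p5 q5]
  /andP[p6 q6] /andP[p7 q7] S7 rho0 rho_le IH.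
pose D := (1 - a1) + (1 - a2) + (1 - a3) + (1 - a4) + (1 - a5) + (1 - a6)
  + (1 - a7).
(* Since [rho <= 7/16], each square is at least 9/16, so 1 - a^2 = (1 - a) (1 + a) is at least 7/4
   times 1 - a; the seven values 1 - a^2 add up to [rho]. *)
have [D_rho D0] : 7 / 4 * D <= rho /\ 0 < D.
  have sq1 a : 0 < a -> a < 1 -> a ^+ 2 <= 1 by move=> ? ?; rewrite expr_le1 // ltW.
  have near a : 0 < a -> 9 / 16 <= a ^+ 2 -> a < 1 ->
      7 / 4 * (1 - a) <= 1 - a ^+ 2.
    move=> a0 a2_ge a_lt; have a_ge : 3 / 4 <= a by nra.
    nra.
  move: (sq1 _ p1 q1) (sq1 _ p2 q2) (sq1 _ p3 q3) (sq1 _ p4 q4)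
    (sq1 _ p5 q5) (sq1 _ p6 q6) (sq1 _ p7 q7) => {sq1} s1 s2 s3 s4 s5 s6 s7.
  have n1 := near _ p1 ltac:(lra) q1. have n2 := near _ p2 ltac:(lra) q2.
  have n3 := near _ p3 ltac:(lra) q3. have n4 := near _ p4 ltac:(lra) q4.
  have n5 := near _ p5 ltac:(lra) q5. have n6 := near _ p6 ltac:(lra) q6.
  have n7 := near _ p7 ltac:(lra) q7.
  by rewrite /D; split; lra.
have D_le : D <= 4^-1 by lra.
(* 7 D^2 <= 16/7 rho^2, and this is at most [rho] exactly when [rho <= 7/16]. *)
have D2 : 7 * D ^+ 2 <= rho by move: D_rho D0 rho_le; clear; nra.
set c := Num.sqrt (7 / rho) in IH.
have c0 : 0 <= c by exact: sqrtr_ge0.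
have c2 : c ^+ 2 = 7 / rho by rewrite sqr_sqrtr // ltW // divr_gt0.
rewrite -[[:: a1, _ & _]]/([:: a1; a2; a3; a4; a5; a6; a7] ++ m).
rewrite sign_avg_catC sign_avg_cat.
apply: (@le_trans _ _ (sign_avg m (fun z => 7 / 16 + 7 / 64 * in_unit (c * z)) 0)).
  apply: sign_avg_le => z.
  have [zD|Dz] := ltrP `|z| D.
    apply: le_trans (sign_avg_seven_near_one z (ltW q1) (ltW q2) (ltW q3)
      (ltW q4) (ltW q5) (ltW q6) (ltW q7) D_le) _.
    have cz : `|c * z| < 1.
      rewrite -(@expr_lt1 _ 2) // real_normK ?num_real // exprMn c2.
      rewrite mulrAC ltr_pdivrMr // mul1r; apply: lt_le_trans D2.
      by rewrite ltr_pM2l // -[ltLHS]real_normK ?num_real // ltr_pXn2r ?nnegrE // ltW.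
    by rewrite /in_unit cz /=; lra.
  apply: le_trans (sign_avg_seven_near_one_shift (ltW q1) (ltW q2) (ltW q3)
    (ltW q4) (ltW q5) (ltW q6) (ltW q7) D_le Dz) _.
  by have := in_unit_ge0 (c * z); lra.
rewrite sign_avgD sign_avg_const sign_avgZ -sign_avg_scale mulr0.
by lra.
Qed.

(** Strong induction on the number of coefficients, sorted in decreasing order; only the case of a
    small tail calls the induction hypothesis. *)
Lemma sign_avg_in_unit_le_half l : (forall a, a \in l -> 0 < a) ->
  \sum_(a <- l) a ^+ 2 = 7 -> sign_avg l in_unit 0 <= 2^-1.
Proof.
have [n] := ubnP (size l); elim: n l => // n IH l.
wlog sl : l / sorted (fun x y => y <= x) l => [wl|] sz pos S7.
  set m := sort (fun x y => y <= x) l.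
  have ml : perm_eq m l by rewrite perm_sort.
  rewrite -(sign_avg_perm _ _ ml); apply: wl; rewrite ?(perm_size ml) //.
  - by apply: sort_sorted => x y; rewrite le_total.
  - by move=> a; rewrite (perm_mem ml) => /pos.
  - by rewrite (perm_big _ ml).
have [/hasP[a al a1]|/hasPn lt1] := boolP (has (fun a => 1 <= a) l).
  exact: sign_avg_one_large_in a1 al.
have {}lt1 a : a \in l -> 0 < a < 1 by move=> al; rewrite pos // ltNge lt1.
(* Squares below 1 need at least eight terms to add up to 7. *)
have size_gt7 : (7 < size l)%N.
  case: l pos S7 lt1 {sl sz} => [|a l] pos S7 lt1; first by move: S7; rewrite big_nil; lra.
  have l_le : \sum_(b <- l) b ^+ 2 <= (size l)%:R.
    apply: sum_sqr_le_size => b bl.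
    have /andP[b0 b1] : 0 < b < 1 by apply: lt1; rewrite in_cons bl orbT.
    by rewrite ger0_norm ltW.
  have a_lt : a ^+ 2 < 1.
    by have /andP[a0 a1] := lt1 a (mem_head _ _); rewrite expr_lt1 // ltW.
  by rewrite -(ltr_nat R) -[7%:R]S7 big_cons /= -natr1; lra.
case: l size_gt7 sl sz pos S7 lt1 => [|a1 [|a2 [|a3 [|a4 [|a5 [|a6 [|a7 [|a8 r]]]]]]]] //.
move=> _ sl sz pos S7 lt1.
have r_le b : b \in a8 :: r -> b <= a8.
  rewrite in_cons => /predU1P[->//|br].
  move: sl => /= /and5P[_ _ _ _] /and4P[_ _ _] /order_path_min pm.
  have tr : transitive (fun x y : R => y <= x) by move=> x y z ? ?; apply: le_trans; eassumption.
  by have /allP := pm tr; apply.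
move: sl => /= /and5P[h1 h2 h3 h4] /and4P[h5 h6 h7 _].
have [a8_ge|a8_lt] := lerP 2^-1 a8.
  by apply: sign_avg_eight_large; lra.
have mem7 b : b \in [:: a1; a2; a3; a4; a5; a6; a7] -> 0 < b < 1.
  move=> b7; apply: lt1.
  by rewrite -[_ :: _]/([:: a1; a2; a3; a4; a5; a6; a7] ++ a8 :: r) mem_cat b7.
have tail0 b : b \in a8 :: r -> 0 < b.
  move=> br; apply: pos.
  by rewrite -[_ :: _]/([:: a1; a2; a3; a4; a5; a6; a7] ++ a8 :: r) mem_cat br orbT.
have [rho_ge|rho_lt] := lerP (7 / 16) (\sum_(a <- a8 :: r) a ^+ 2).
  apply: (@sign_avg_fourier _ [:: a1; a2; a3; a4; a5; a6; a7] (a8 :: r)) => //.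
  - by move=> b /mem7/andP[b0 b1]; rewrite ger0_norm ltW.
  - by move=> b br; have := tail0 _ br; have := r_le _ br => b8 b0;
      rewrite ger0_norm; lra.
have rho0 : 0 < \sum_(a <- a8 :: r) a ^+ 2.
  rewrite big_cons ltr_wpDr ?sumr_ge0 ?exprn_gt0 ?tail0 ?mem_head // => b _.
  exact: sqr_ge0.
have S7' : a1 ^+ 2 + a2 ^+ 2 + a3 ^+ 2 + a4 ^+ 2 + a5 ^+ 2 + a6 ^+ 2 + a7 ^+ 2
    + \sum_(a <- a8 :: r) a ^+ 2 = 7.
  by move: S7; rewrite 7!big_cons !addrA.
(* The tail is shorter than [l], and rescaling restores its sum of squares to 7. *)
have IHr : sign_avg
    [seq Num.sqrt (7 / \sum_(a <- a8 :: r) a ^+ 2) * b | b <- a8 :: r]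
    in_unit 0 <= 2^-1.
  apply: IH.
  - by rewrite size_map; move: sz => /=; clear; lia.
  - move=> b /mapP[b' b'r ->]; apply: mulr_gt0; last exact: tail0.
    by rewrite sqrtr_gt0 divr_gt0.
  - rewrite big_map; under eq_bigr => b _ do rewrite exprMn.
    rewrite -mulr_sumr sqr_sqrtr ?mulfVK ?gt_eqF //.
    by rewrite ltW // divr_gt0.
by apply: (sign_avg_near_one _ _ _ _ _ _ _ S7' rho0 (ltW rho_lt) IHr);
  apply: mem7; rewrite !inE eqxx ?orbT.
Qed.

End HalfBound.

(** * From sign patterns to probability *)

Section SignPatterns.
Variables (R : realType) (d : measure_display) (T : measurableType d).
Variables (P : probability T R) (n : nat) (a : 'I_n -> R).
Variable e : 'I_n -> {RV P >-> R}.
Hypothesis e_rademacher : forall i, rademacher (e i).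
Hypothesis e_indep : mutually_independent e.

(** The event that the signs indexed by [J] follow the pattern [s], where [true] encodes -1. *)
Let cylinder (J : {set 'I_n}) (s : 'I_n -> bool) : set T :=
  \bigcap_(i in [set` J]) (e i @^-1` [set (-1) ^+ s i]).

Let measurable_cylinder J s : measurable (cylinder J s).
Proof.
by apply: fin_bigcap_measurable.
Qed.

Let prob_cylinder J s : P (cylinder J s) = (2^-1 ^+ #|J|)%:E.
Proof.
rewrite /cylinder (e_indep (B := fun i => [set (-1) ^+ s i])); last first.
  by move=> i _; exact: measurable_set1.
rewrite (eq_bigr (fun=> (2^-1)%:E)) => [|i _].
  by rewrite prodEFin prodr_const.
by have [e1 eN1] := e_rademacher i; case: (s i); rewrite ?expr0 ?expr1.
Qed.

Let signed_sum (J : {set 'I_n}) (s : 'I_n -> bool) : R :=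
  \sum_(i in J) a i * (-1) ^+ s i.

(* r lists the indices whose signs are not yet prescribed by the cylinder. *)
Let prob_cylinder_ge (S : set R) (r : seq 'I_n) (s : 'I_n -> bool) :
  measurable (rademacher_sum a e @^-1` S) -> uniq r ->
  (((2^-1) ^+ (n - size r)%N * sign_avg [seq a i | i <- r] \1_S
      (signed_sum (~: [set i in r]) s))%R%:E <=
  P (cylinder (~: [set i in r]) s `&` rademacher_sum a e @^-1` S))%E.
Proof.
move=> mS; elim: r s => [|i r IH] s.
  move=> _ /=; have -> : ~: [set i in [::]] = [set: 'I_n]%SET.
    by apply/setP => i; rewrite !inE.
  (* With all signs prescribed the sum is constant on the cylinder, which therefore lies inside the
     event as soon as that constant is in [S]. *)
  rewrite subn0 indicE; case: (boolP (_ \in S)) => [|_]; last first.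
    by rewrite mulr0 measure_ge0.
  rewrite inE mulr1 => sumS.
  rewrite (_ : _ `&` _ = cylinder [set: 'I_n]%SET s) ?prob_cylinder ?cardsT ?card_ord //.
  apply/setIidPl => t et /=; move: sumS; congr S.
  rewrite /signed_sum /rademacher_sum big_mkcond /=; apply: eq_bigr => i _.
  by rewrite inE; congr (_ * _); have /= <- := et i; rewrite ?inE.
move=> /=/andP[ir ur].
pose s_ b j := if j == i then b else s j.
have cyl b t : cylinder (~: [set j in r]) (s_ b) t ->
    e i t = (-1) ^+ b /\ cylinder (~: [set j in i :: r]) s t.
  move=> ct; split.
    by have := ct i; rewrite /= !inE /s_ eqxx; apply.
  move=> j /=; rewrite !inE negb_or => /andP[ji jr].
  by have := ct j; rewrite /= !inE /s_ (negbTE ji); apply.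
have sum_s b : signed_sum (~: [set j in r]) (s_ b) =
    signed_sum (~: [set j in i :: r]) s + a i * (-1) ^+ b.
  rewrite /signed_sum (bigD1 i) /= ?inE // addrC /s_ eqxx; congr (_ + _).
  apply: eq_big => [j|j /andP[_ /negbTE ->] //].
  by rewrite !inE negb_or andbC.
(* Prescribing the sign at [i] as well gives two disjoint subevents, to which the induction
   hypothesis applies. *)
set C := cylinder _ _; pose D b := cylinder (~: [set j in r]) (s_ b)
  `&` rademacher_sum a e @^-1` S.
have mD b : measurable (D b) by exact: measurableI.
have D01 : D false `&` D true = set0.
  apply/seteqP; split => // t [[/cyl[e0 _] _] [/cyl[e1 _] _]].
  by move: e1; rewrite e0 expr0 expr1; lra.
apply: (@le_trans _ _ (P (D false `|` D true))); last first.
  apply: le_measure; [exact/mem_set/measurableU|apply/mem_set|].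
    exact: measurableI (measurable_cylinder _ _) mS.
  by move=> t [|] [/cyl[_ ct] St].
rewrite measureU //; have := leeD (IH (s_ false) ur) (IH (s_ true) ur).
apply: le_trans; rewrite !sum_s expr0 expr1 mulr1 mulrN1 -EFinD lee_fin.
(* Subtraction on naturals truncates: this bound makes [n - size r] the successor of
   [n - size (i :: r)], which supplies the factor 1/2. *)
have size_r : (size (i :: r) <= n)%N.
  have /card_uniqP <- : uniq (i :: r) by rewrite /= ir.
  by rewrite -[X in (_ <= X)%N]card_ord max_card.
by rewrite -mulrDr -[in leRHS](subnSK size_r) exprS; lra.
Qed.

(** All signs start free. Outcomes where some [e i] is neither 1 nor -1 are discarded, hence an
    inequality, in the direction that the theorem asks for. *)
Lemma prob_sum_ge (S : set R) : measurable S ->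
  ((sign_avg [seq a i | i <- enum 'I_n] \1_S 0)%:E <=
  P (rademacher_sum a e @^-1` S))%E.
Proof.
move=> mS; pose X := rademacher_sum a e.
have mX : measurable_fun setT X.
  by apply: measurable_sum => i; apply: measurable_realfun.measurable_funM.
have mXS : measurable (X @^-1` S) by rewrite -[X in measurable X]setTI; exact: mX.
have := prob_cylinder_ge (fun=> false) mXS (enum_uniq 'I_n).
have -> : ~: [set i in enum 'I_n] = finset.set0.
  by apply/setP => i; rewrite !inE mem_enum.
rewrite size_enum_ord subnn expr0 mul1r /signed_sum big_set0 => /le_trans; apply.
by apply: le_measure; [apply/mem_set|exact/mem_set|exact: subIsetr];
  exact: measurableI (measurable_cylinder _ _) mXS.
Qed.

End SignPatterns.

Theorem theorem5p1 (R : realType) (d : measure_display)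
    (T : measurableType d) (P : probability T R)
    (n : nat) (a : 'I_n -> R) (e : 'I_n -> {RV P >-> R})
    (a_coefs : unit_variance_coefs a)
    (e_rademacher : forall i : 'I_n, rademacher (e i))
    (e_indep : mutually_independent e) :
  ((2^-1)%:E <= P [set t | (1 / Num.sqrt 7 <= `|rademacher_sum a e t|)%R])%E.
Proof.
have [_ a_gt0 a_sum1] := a_coefs.
pose S : set R := [set x | 1 / Num.sqrt 7 <= `|x|].
have s7_gt0 : 0 < Num.sqrt 7 :> R by rewrite sqrtr_gt0.
have mS : measurable S.
  rewrite (_ : S = (fun x : R => `|x|) @^-1` `[1 / Num.sqrt 7, +oo[).
    by rewrite -[X in measurable X]setTI; exact: measurable_realfun.normr_measurable.
  by apply/seteqP; split => x /=; rewrite in_itv /= andbT.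
apply: le_trans (prob_sum_ge a e_rademacher e_indep mS); rewrite lee_fin.
set l := [seq a i | i <- _].
have half : sign_avg [seq Num.sqrt 7 * b | b <- l] in_unit 0 <= 2^-1.
  apply: sign_avg_in_unit_le_half.
    by move=> b /mapP[_ /mapP[i _ ->] ->]; rewrite mulr_gt0.
  rewrite /l 2!big_map big_enum /=; under eq_bigr => i _ do rewrite exprMn.
  by rewrite -mulr_sumr a_sum1 mulr1 sqr_sqrtr.
(* [S] is the complement of the interval |x| < 1 / sqrt 7, that is, of |sqrt 7 * x| < 1. *)
have -> : sign_avg l \1_S 0 =
    sign_avg l (fun x => 1 + -1 * in_unit (Num.sqrt 7 * x)) 0.
  apply: eq_sign_avg => x.
  rewrite indicE /in_unit normrM (gtr0_norm s7_gt0) ltNge.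
  have -> : (x \in S) = (1 <= Num.sqrt 7 * `|x|).
    by rewrite -ler_pdivrMl // mulrC; apply/idP/idP; rewrite inE.
  by case: (1 <= _) => /=; lra.
rewrite sign_avgD sign_avg_const sign_avgZ -sign_avg_scale mulr0.
by lra.
Qed.
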